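(* Let $\mathbb{L},t,\lambda_2,\lambda_3,\dots$ be independent variables, put $\lambda_1=\mathbb{L}$, and let $(G_{k,m})_{k,m\ge1}$ be a family satisfying $G_{1,1}=(\mathbb{L}-1)^2\mathbb{L}^{-2}$ and, for all $k,m\geq 1$, the relations $$G_{k,m}=G_{m,k};\qquad G_{k,m}=t^{k(k-1)}\mathbb{L}^{-k}\,G_{k,m-k}\ \text{ for } m>k;\qquad G_{k,k}=(\lambda_k-1)\sum_{m>k}G_{k,m}.$$ Let $k,m\ge1$ and $a=\gcd(k,m)$. Then $$G_{k,m}=(\mathbb{L}-1)^2\, t^{(k-1)(m-1)}\,\mathbb{L}^{-k-m}\sum_{\underline{a},\underline{b}}\ \prod_{j=1}^{r}\mu\!\left(\frac{b_j}{a_{j-1}}\right)\frac{(\lambda_{a_j}-1)\,t^{(a_j-1)b_j}\,\mathbb{L}^{-b_j}\left(1-t^{(a_j-1)(a_j-b_j)}\mathbb{L}^{b_j-a_j}\right)}{\left(1-\lambda_{a_j}t^{a_j(a_j-1)}\mathbb{L}^{-a_j}\right)\left(1-t^{(a_j-1)b_j}\mathbb{L}^{-b_j}\right)},$$ where $\mu$ is the Möbius function and the sum is over all $r\ge0$ and all tuples of integers $$1=a_0\le b_1<a_1\le b_2<a_2\le\cdots\le a_{r-1}\le b_r<a_r=a$$ such that $a_{j-1}\mid b_j$ and $b_j\mid a_j$ for all $j$ ($r$ is not fixed; for $a=1$ the only tuple is $r=0$, with empty product equal to $1$).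
   Context: The $G_{k,m}=G_{k,m}(t,\mathbb{L};\lambda_2,\lambda_3,\dots)$ are elements of the ring $\mathbb{Z}[\lambda_2,\lambda_3,\dots]((\mathbb{L}^{-1}))[[t]]$ of formal power series in $t$ whose coefficients are formal Laurent series in $\mathbb{L}^{-1}$ over $\mathbb{Z}[\lambda_2,\lambda_3,\dots]$. Infinite sums converge coefficientwise in $t$, in the $\mathbb{L}^{-1}$-adic topology, and rational expressions are expanded in this ring. (The value $\lambda_1=\mathbb{L}$ is forced by the relations with $k=1$.) *)

(* Defs.v *)
From HB Require Import structures.
From mathcomp Require Import all_boot all_order all_algebra.
From mathcomp Require Import zify.
From mathcomp Require Import xfinmap monalg.
From mathcomp Require Import boolp classical_sets functions cardinality fsbigop.

Set Implicit Arguments.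
Unset Strict Implicit.
Unset Printing Implicit Defensive.
Import Order.TTheory GRing.Theory Num.Theory.
Local Open Scope ring_scope.

Record fps (R : Type) := FPS { fcoef : nat -> R }.

Lemma fpsP (R : Type) (f g : fps R) : fcoef f =1 fcoef g -> f = g.
Proof. by case: f; case: g => f g /= /funext ->. Qed.

HB.instance Definition _ (R : Type) := gen_eqMixin (fps R).
HB.instance Definition _ (R : Type) := gen_choiceMixin (fps R).

Section FpsRing.
Variable R : comNzRingType.
Implicit Types f g h : fps R.

Definition fadd f g := FPS (fun n => fcoef f n + fcoef g n).
Definition fopp f := FPS (fun n => - fcoef f n).
Definition fpsC (c : R) := FPS (fun n => if n == 0%N then c else 0).
Definition fmul f g :=
  FPS (fun n => \sum_(i < n.+1) fcoef f i * fcoef g (n - i)%N).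

Lemma faddA : associative fadd.
Proof. by move=> f g h; apply: fpsP => n /=; rewrite addrA. Qed.
Lemma faddC : commutative fadd.
Proof. by move=> f g; apply: fpsP => n /=; rewrite addrC. Qed.
Lemma fadd0 : left_id (fpsC 0) fadd.
Proof. by move=> f; apply: fpsP => n /=; case: eqP; rewrite add0r. Qed.
Lemma faddN : left_inverse (fpsC 0) fopp fadd.
Proof. by move=> f; apply: fpsP => n /=; case: eqP; rewrite addNr. Qed.

HB.instance Definition _ :=
  GRing.isZmodule.Build (fps R) faddA faddC fadd0 faddN.

Definition fagree n f (p : {poly R}) := forall k, (k <= n)%N -> fcoef f k = p`_k.

Lemma fagree_trunc n f : fagree n f (\poly_(i < n.+1) fcoef f i).
Proof. by move=> k kn; rewrite coef_poly ltnS kn. Qed.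

Arguments fagree_trunc : clear implicits.

Lemma fagree_mul n f g p q :
  fagree n f p -> fagree n g q -> fagree n (fmul f g) (p * q).
Proof.
move=> fp gq k kn /=; rewrite coefM; apply: eq_bigr => i _.
rewrite fp ?gq //; first exact: leq_trans (leq_subr _ _) kn.
by rewrite (leq_trans _ kn) // -ltnS.
Qed.

Lemma fmulA : associative fmul.
Proof.
move=> f g h; apply: fpsP => n; have T := fagree_trunc n.
rewrite (fagree_mul (T f) (fagree_mul (T g) (T h))) //.
by rewrite (fagree_mul (fagree_mul (T f) (T g)) (T h)) // mulrA.
Qed.

Lemma fmulC : commutative fmul.
Proof.
move=> f g; apply: fpsP => n; have T := fagree_trunc n.
rewrite (fagree_mul (T f) (T g)) //.
by rewrite (fagree_mul (T g) (T f)) // mulrC.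
Qed.

Lemma fmul1 : left_id (fpsC 1) fmul.
Proof.
move=> f; apply: fpsP => n /=; rewrite big_ord_recl /= mul1r subn0.
by rewrite big1 ?addr0 // => i _; rewrite mul0r.
Qed.

Lemma fmulDl : left_distributive fmul fadd.
Proof.
move=> f g h; apply: fpsP => n /=; rewrite -big_split /=.
by apply: eq_bigr => i _; rewrite mulrDl.
Qed.

Lemma fone_neq0 : fpsC 1 != fpsC 0.
Proof.
by apply/eqP => /(congr1 (fun f => fcoef f 0)) /eqP /=; rewrite oner_eq0.
Qed.

HB.instance Definition _ := GRing.Zmodule_isComNzRing.Build (fps R)
  fmulA fmulC fmul1 fmulDl fone_neq0.

Definition funit : {pred fps R} := fun f => `[< exists g, g * f = 1 >].
Definition finv f : fps R :=
  if pselect (exists g, g * f = 1) is left fu then projT1 (cid fu) else f.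

Lemma fmulV : {in funit, left_inverse 1 finv *%R}.
Proof.
move=> f /asboolP fu; rewrite /finv; case: pselect => // {}fu.
exact: projT2 (cid fu).
Qed.
Lemma funitPl f g : g * f = 1 -> funit f.
Proof. by move=> gf; apply/asboolP; exists g. Qed.
Lemma finv_out : {in [predC funit], finv =1 id}.
Proof.
move=> f /negP nfu; rewrite /finv; case: pselect => // fu.
by case: nfu; apply/asboolP.
Qed.

HB.instance Definition _ := GRing.ComNzRing_hasMulInverse.Build (fps R)
  fmulV funitPl finv_out.

Definition fpsX : fps R := FPS (fun n => (n == 1%N)%:R).

Lemma fcoefD f g n : fcoef (f + g) n = fcoef f n + fcoef g n.
Proof. by []. Qed.
Lemma fcoefN f n : fcoef (- f) n = - fcoef f n.
Proof. by []. Qed.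
Lemma fcoefM f g n :
  fcoef (f * g) n = \sum_(i < n.+1) fcoef f i * fcoef g (n - i)%N.
Proof. by []. Qed.

Lemma fpsC_mul (c d : R) : fpsC (c * d) = fpsC c * fpsC d.
Proof.
apply: fpsP => n; rewrite fcoefM big_ord_recl /= subn0 big1.
  by rewrite addr0; case: eqP => //; rewrite mulr0.
by move=> i _; rewrite mul0r.
Qed.

Fixpoint finv_seq f n : seq R :=
  if n is n'.+1 then
    let s := finv_seq f n' in
    rcons s ((n' == 0%N)%:R - \sum_(i < n') fcoef f (n' - i)%N * s`_i)
  else [::].

Lemma funit_coef0 f : fcoef f 0 = 1 -> f \is a GRing.unit.
Proof.
move=> f0; pose g := FPS (fun n => (finv_seq f n.+1)`_n).
have sz n : size (finv_seq f n) = n by elim: n => //= n IH; rewrite size_rcons IH.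
have nthE n i : (i < n)%N -> (finv_seq f n)`_i = fcoef g i.
  elim: n => // n IH; rewrite ltnS leq_eqVlt => /orP [/eqP -> //|ltin].
  by rewrite [finv_seq f n.+1]/= nth_rcons sz ltin IH.
have gE n : fcoef g n = (n == 0%N)%:R - \sum_(i < n) fcoef f (n - i)%N * fcoef g i.
  rewrite [LHS]/= nth_rcons sz ltnn eqxx; congr (_ - _).
  by apply: eq_bigr => i _; rewrite nthE.
suff : g * f = 1 by exact: funitPl.
move: (g) gE {nthE} => {}g gE.
apply: fpsP => n; rewrite fcoefM big_ord_recr /= gE subnn f0 mulr1.
rewrite addrC -addrA [X in _ + X](_ : _ = 0) ?addr0; first by case: eqP.
apply/eqP; rewrite addrC subr_eq0; apply/eqP/eq_bigr => i _.
by rewrite mulrC.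
Qed.

End FpsRing.

(* Formal Laurent series in x over R; [lcoef f n] is the coefficient of x^n. *)
Record laurent (R : nmodType) := Laurent {
  lcoef : int -> R;
  lcoef_bounded : exists N, forall n, n < N -> lcoef n = 0 }.

Lemma laurentP (R : nmodType) (f g : laurent R) : lcoef f =1 lcoef g -> f = g.
Proof.
case: f g => f fP [g gP] /= /funext fg; subst g.
by rewrite (Prop_irrelevance fP gP).
Qed.

HB.instance Definition _ (R : nmodType) := gen_eqMixin (laurent R).
HB.instance Definition _ (R : nmodType) := gen_choiceMixin (laurent R).

Section LaurentRing.
Variable R : comNzRingType.
Implicit Types f g h : laurent R.

Definition lbnd f (N : int) := forall n, n < N -> lcoef f n = 0.

Lemma lbnd_le f N M : M <= N -> lbnd f N -> lbnd f M.
Proof. by move=> MN fN n nM; apply: fN; apply: lt_le_trans MN. Qed.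

Fact lmono_bounded (e : int) (c : R) :
  exists N : int, forall n : int, n < N -> (if n == e then c else 0) = 0.
Proof. by exists e => n; case: eqP => // ->; rewrite ltxx. Qed.
Definition lmono e c := Laurent (lmono_bounded e c).

Fact ladd_bounded f g :
  exists N, forall n, n < N -> lcoef f n + lcoef g n = 0.
Proof.
case: (lcoef_bounded f) (lcoef_bounded g) => N fN [M gM].
exists (Order.min N M) => n; rewrite lt_min => /andP [nN nM].
by rewrite fN ?gM ?addr0.
Qed.
Definition ladd f g := Laurent (ladd_bounded f g).

Fact lopp_bounded f : exists N, forall n, n < N -> - lcoef f n = 0.
Proof.
by case: (lcoef_bounded f) => N fN; exists N => n nN; rewrite fN ?oppr0.
Qed.
Definition lopp f := Laurent (lopp_bounded f).

Lemma laddA : associative ladd.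
Proof. by move=> f g h; apply: laurentP => n /=; rewrite addrA. Qed.
Lemma laddC : commutative ladd.
Proof. by move=> f g; apply: laurentP => n /=; rewrite addrC. Qed.
Lemma ladd0 : left_id (lmono 0 0) ladd.
Proof. by move=> f; apply: laurentP => n /=; case: eqP; rewrite add0r. Qed.
Lemma laddN : left_inverse (lmono 0 0) lopp ladd.
Proof. by move=> f; apply: laurentP => n /=; case: eqP; rewrite addNr. Qed.

HB.instance Definition _ :=
  GRing.isZmodule.Build (laurent R) laddA laddC ladd0 laddN.

(* Finitely many nonzero terms, because both supports are bounded below. *)
Definition lconv f g (n : int) : R :=
  \sum_(i \in [set: int]%classic) lcoef f i * lcoef g (n - i).

Lemma lconvE f g N M (k : nat) : lbnd f N -> lbnd g M ->
  lconv f g (N + M + k%:Z) =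
    \sum_(i < k.+1) lcoef f (N + i%:Z) * lcoef g (M + (k - i)%N%:Z).
Proof.
move=> fN gM; rewrite /lconv.
rewrite (@fsbigE _ _ _ _ _ [seq N + i%:Z | i <- iota 0 k.+1]) //.
- rewrite big_map -[k.+1]subn0 -/(index_iota 0 k.+1) subn0 big_mkord.
  rewrite [LHS](_ : _ = \sum_(i < k.+1)
    lcoef f (N + i%:Z) * lcoef g (N + M + k%:Z - (N + i%:Z))); last first.
    by rewrite big_mkcond /=; apply: eq_bigr => i _; rewrite in_setT.
  apply: eq_bigr => i _; congr (_ * lcoef g _).
  have := ltn_ord i; lia.
- by rewrite map_inj_uniq ?iota_uniq // => i j /addrI [].
- move=> i _ /mapP ni; have [iN|Ni] := ltP i N; first by rewrite fN ?mul0r.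
  have [kM|Mk] := ltP (N + M + k%:Z - i) M; first by rewrite gM ?mulr0.
  case: ni; exists `|i - N|%N; last by lia.
  by rewrite mem_iota; lia.
Qed.

Lemma lconv0 f g N M n : lbnd f N -> lbnd g M -> n < N + M -> lconv f g n = 0.
Proof.
move=> fN gM nNM; rewrite /lconv fsbig1 // => i _.
have [iN|Ni] := ltP i N; first by rewrite fN ?mul0r.
by rewrite gM ?mulr0 // ltrBlDl; apply: lt_le_trans nNM _; rewrite lerD2r.
Qed.

Fact lmul_bounded f g : exists N, forall n, n < N -> lconv f g n = 0.
Proof.
case: (lcoef_bounded f) (lcoef_bounded g) => N fN [M gM].
by exists (N + M) => n; apply: lconv0.
Qed.
Definition lmul f g := Laurent (lmul_bounded f g).

Definition lshift (N : int) f : fps R := FPS (fun k => lcoef f (N + k%:Z)).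

Lemma lbnd_mul f g N M : lbnd f N -> lbnd g M -> lbnd (lmul f g) (N + M).
Proof. by move=> fN gM n; apply: lconv0. Qed.

Lemma lshift_mul f g N M : lbnd f N -> lbnd g M ->
  lshift (N + M) (lmul f g) = lshift N f * lshift M g.
Proof. by move=> fN gM; apply: fpsP => k /=; apply: lconvE. Qed.

Lemma lshift_inj f g N : lbnd f N -> lbnd g N -> lshift N f = lshift N g -> f = g.
Proof.
move=> fN gN fg; apply: laurentP => n.
have [nN|Nn] := ltP n N; first by rewrite fN ?gN.
have -> : n = N + `|n - N|%N%:Z by lia.
exact: (congr1 (fun s => fcoef s `|n - N|%N) fg).
Qed.

Lemma lmulA : associative lmul.
Proof.
move=> f g h; have [[N fN] [M gM] [P hP]] :=
  And3 (lcoef_bounded f) (lcoef_bounded g) (lcoef_bounded h).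
have b1 := lbnd_mul fN (lbnd_mul gM hP).
have b2 := lbnd_mul (lbnd_mul fN gM) hP.
apply: (lshift_inj b1); first by rewrite addrA.
rewrite (lshift_mul fN (lbnd_mul gM hP)) (lshift_mul gM hP) mulrA.
by rewrite addrA (lshift_mul (lbnd_mul fN gM) hP) (lshift_mul fN gM).
Qed.

Lemma lmulC : commutative lmul.
Proof.
move=> f g; have [[N fN] [M gM]] := conj (lcoef_bounded f) (lcoef_bounded g).
apply: (lshift_inj (lbnd_mul fN gM)).
  by rewrite addrC; exact: lbnd_mul gM fN.
by rewrite (lshift_mul fN gM) addrC (lshift_mul gM fN) mulrC.
Qed.

Lemma lmul1 : left_id (lmono 0 1) lmul.
Proof.
move=> f; have [N fN] := lcoef_bounded f.
have b1 : lbnd (lmono 0 1) 0 by move=> n; rewrite /=; case: eqP => // ->.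
apply: (lshift_inj (lbnd_mul b1 fN)); first by rewrite add0r.
by rewrite (lshift_mul b1 fN) add0r -[RHS]mul1r; congr (_ * _).
Qed.

Lemma lmulDl : left_distributive lmul ladd.
Proof.
move=> f g h; have [[N fN] [M gM] [P hP]] :=
  And3 (lcoef_bounded f) (lcoef_bounded g) (lcoef_bounded h).
pose K := Order.min N M.
have fK : lbnd f K by apply: lbnd_le fN; rewrite ge_min lexx.
have gK : lbnd g K by apply: lbnd_le gM; rewrite ge_min lexx orbT.
have ladd_bnd f' g' Q : lbnd f' Q -> lbnd g' Q -> lbnd (ladd f' g') Q.
  by move=> f'Q g'Q n nQ /=; rewrite f'Q ?g'Q ?addr0.
have fgK : lbnd (ladd f g) K by apply: ladd_bnd.
apply: (lshift_inj (lbnd_mul fgK hP)).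
  exact: ladd_bnd (lbnd_mul fK hP) (lbnd_mul gK hP).
have shD Q f' g' : lshift Q (ladd f' g') = lshift Q f' + lshift Q g' by [].
by rewrite shD (lshift_mul fgK hP) (lshift_mul fK hP) (lshift_mul gK hP) shD mulrDl.
Qed.

Lemma lone_neq0 : lmono 0 1 != lmono 0 0.
Proof.
by apply/eqP => /(congr1 (fun f => lcoef f 0)) /eqP /=; rewrite oner_eq0.
Qed.

HB.instance Definition _ := GRing.Zmodule_isComNzRing.Build (laurent R)
  lmulA lmulC lmul1 lmulDl lone_neq0.

Lemma lmonoM e e' (c d : R) : lmono e c * lmono e' d = lmono (e + e') (c * d).
Proof.
have b x (z : R) : lbnd (lmono x z) x.
  by move=> n /=; case: eqP => // ->; rewrite ltxx.
apply: (lshift_inj (lbnd_mul (b e c) (b e' d)) (b _ _)).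
rewrite [LHS](lshift_mul (b e c) (b e' d)).
have E x (z : R) : lshift x (lmono x z) = fpsC z.
  by apply: fpsP => k /=; rewrite -[X in _ == X]addr0 (inj_eq (addrI _)).
by rewrite !E fpsC_mul.
Qed.

End LaurentRing.

(* The ring Z[lambda_2, lambda_3, ...]((L^-1))[[t]].  The polynomial variable
   of index i is lambda_(i+2); [lcoef f n] is the coefficient of L^-n. *)
Definition lambda_ring : comNzRingType := {malg int[{cmonom nat}]}.
Definition Gring : comUnitRingType := fps (laurent lambda_ring).

Definition tvar : Gring := fpsX _.
Definition Lvar : Gring := fpsC (lmono (-1) 1).
(* lambda_1 = L; the value at 0 is never used. *)
Definition lambda (k : nat) : Gring :=
  if (k <= 1)%N then Lvar
  else fpsC (lmono 0 (<< ucm (k - 2)%N >> : {malg int[{cmonom nat}]})).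

(* Convergence coefficientwise in t, for the L^-1-adic topology: modulo every
   L^-N, each coefficient of t^i is eventually constant. *)
Definition Gring_cvg (u : nat -> Gring) (l : Gring) : Prop :=
  forall (i : nat) (N : int), exists n0 : nat, forall n : nat, (n0 <= n)%N ->
  forall e : int, e < N -> lcoef (fcoef (u n) i) e = lcoef (fcoef l i) e.

(* [sum_gt k u s]: the series of the u m over m > k converges to s. *)
Definition sum_gt (k : nat) (u : nat -> Gring) (s : Gring) : Prop :=
  Gring_cvg (fun n => \sum_(k.+1 <= m < n) u m) s.

(* The value at 0, never used, is 0. *)
Definition moebius (n : nat) : int :=
  if (0 < n)%N && all (fun p => logn p n == 1%N) (primes n)
  then (-1) ^+ size (primes n) else 0.

(* A pair (a_0 .. a_r, b_1 .. b_r); note that b is numbered from 1. *)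
Definition tuple_a (ab : seq nat * seq nat) (j : nat) : nat := nth 0%N ab.1 j.
Definition tuple_b (ab : seq nat * seq nat) (j : nat) : nat := nth 0%N ab.2 j.-1.

(* 1 = a_0 <= b_1 < a_1 <= ... <= b_r < a_r = a, each term dividing the next. *)
Definition chain (a : nat) (ab : seq nat * seq nat) : Prop :=
  let r := size ab.2 in
  [/\ size ab.1 = r.+1, tuple_a ab 0 = 1%N, tuple_a ab r = a &
    forall j : nat, (1 <= j <= r)%N ->
      [/\ (tuple_a ab j.-1 <= tuple_b ab j)%N, (tuple_b ab j < tuple_a ab j)%N,
          (tuple_a ab j.-1 %| tuple_b ab j)%N & (tuple_b ab j %| tuple_a ab j)%N]].

Lemma chain_finite (a : nat) : finite_set [set ab | chain a ab]%classic.
Proof.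
pose S n := [set` [seq map (@nat_of_ord a.+1) (val t) | t : n.-tuple 'I_a.+1]]%classic.
pose U := (\bigcup_(n in `I_a.+3) S n)%classic.
have finU : finite_set U.
  by apply: bigcup_finite => [|n _]; [exact: finite_II | exact: finite_seq].
have SU (s : seq nat) : (size s < a.+3)%N ->
    (forall j, (j < size s)%N -> (nth 0%N s j <= a)%N) -> U s.
  move=> sz le_a; exists (size s) => //=.
  have tP : size (map (inord : nat -> 'I_a.+1) s) == size s by rewrite size_map.
  apply/mapP; exists (Tuple tP); first by rewrite mem_enum.
  rewrite /= -map_comp -[LHS]map_id; apply/eq_in_map => x /(nthP 0%N) [j js <-] /=.
  by rewrite inordK // ltnS le_a.
apply: (@sub_finite_set _ _ (U `*` U)%classic); last exact: finite_setX.
move=> [aa bb] [/=]; rewrite /tuple_a /tuple_b /= => saa a0 ar ch.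
have mono d j : (j + d <= size bb)%N -> (nth 0%N aa j + d <= nth 0%N aa (j + d))%N.
  elim: d => [|d IH] jd; first by rewrite !addn0.
  have /ch [] : (1 <= (j + d).+1 <= size bb)%N by lia.
  have : (j + d <= size bb)%N by lia.
  by move=> /IH; rewrite !addnS /=; lia.
have sb : (size bb <= a)%N.
  by have := mono (size bb) 0%N (leqnn _); rewrite add0n -ar /=; lia.
have aj j : (j <= size bb)%N -> (nth 0%N aa j <= a)%N.
  move=> jb; have := mono (size bb - j)%N j; rewrite subnKC // -ar /=.
  by move=> /(_ (leqnn _)); lia.
split; apply: SU => /=; [by rewrite saa !ltnS ltnW | | by rewrite ltnS leqW // leqW | ].
- by move=> j; rewrite saa ltnS; apply: aj.
- move=> j jb; have /ch [] : (1 <= j.+1 <= size bb)%N by exact: jb.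
  move=> /= _ + _ _; have := aj j.+1 jb; lia.
Qed.

Lemma Lvar_unit : Lvar \is a GRing.unit.
Proof.
apply/unitrPr; exists (fpsC (lmono 1 1)).
by rewrite /Lvar -fpsC_mul lmonoM mulr1 addNr.
Qed.

(* Main.v *)
(* Put y = t^(k-1) / L and x = y^k, so that G_{k,m} = x G_{k,m-k} for m > k.
   Subtracting from the series over m > k its shift by k leaves a finite sum, and
   the diagonal relation becomes
     (1 - lambda_k x) G_{k,k} = (lambda_k - 1) x \sum_(1 <= r < k) G_{k,r}.
   The Euclidean algorithm expresses every G_{k,m} through the diagonal entry at
   a = gcd(k, m): G_{k,m} = (L-1)^2 t^((k-1)(m-1)) L^(-k-m) H(a), where H satisfies
     (1 - lambda_k x) H(k) = (lambda_k - 1) \sum_(1 <= r < k) y^r H(gcd(k, r)).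
   Moebius inversion, H(n) = \sum_(b | n) F(b) with
   F(b) = \sum_(c | b) mu(b/c) H(c), and the geometric sum over the multiples
   r < k of b turn this into a recursion of H(k) on the pairs c | b | k with
   b < k, which is how the sum over chains unfolds at its last step. *)
Require Import Defs.
From mathcomp Require Import all_boot all_order all_algebra.
From mathcomp Require Import classical_sets fsbigop.
From mathcomp Require Import zify ring.
From mathcomp Require Import finmap boolp cardinality.
Import GRing.Theory.
Local Open Scope ring_scope.

Set Implicit Arguments.
Unset Strict Implicit.
Unset Printing Implicit Defensive.

(** * The Moebius function and Moebius inversion over divisors *)

(** The new prime p has valuation 1 and the valuations at the primes of d do not change, so only the
    sign flips. *)
Lemma moebius_mul_prime (p d : nat) :
  prime p -> (0 < d)%N -> ~~ (p %| d)%N -> moebius (p * d) = - moebius d.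
Proof.
move=> p_pr d0 pNd; have p0 := prime_gt0 p_pr.
have perm : perm_eq (primes (p * d)) (p :: primes d).
  apply: uniq_perm; rewrite /= ?primes_uniq ?mem_primes ?p_pr ?d0 ?pNd //.
  by move=> q; rewrite primesM // primes_prime // !inE.
rewrite /moebius muln_gt0 p0 d0 (perm_all _ perm) (perm_size perm) /=.
rewrite lognM // logn_prime // eqxx lognE p_pr d0 (negPf pNd) /=.
have -> : all (fun q => logn q (p * d) == 1)%N (primes d) =
          all (fun q => logn q d == 1)%N (primes d).
  apply: eq_in_all => q; rewrite mem_primes d0 => /andP [_ qd].
  rewrite lognM // logn_prime //; case: (eqVneq q p) => [qp|//].
  by rewrite qp (negPf pNd) in qd.
by case: ifP => _; rewrite ?oppr0 // exprS mulN1r.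
Qed.

Lemma moebius_square_dvd (p d : nat) :
  prime p -> (p * p %| d)%N -> moebius d = 0.
Proof.
move=> p_pr pd; rewrite /moebius; case: ifP => // /andP [d0 /allP sqf].
have : p \in primes d by rewrite mem_primes p_pr d0 (dvdn_trans (dvdn_mulr _ _) pd).
by move=> /sqf /eqP; have := pd; rewrite mulnn pfactor_dvdn //; lia.
Qed.

(* The squarefree divisors of n pair off as d, p * d for a fixed prime p | n. *)
Lemma sum_moebius_divisors (n : nat) :
  (0 < n)%N -> \sum_(d <- divisors n) moebius d = (n == 1%N)%:R.
Proof.
move=> n0; have [->|n1] := eqVneq n 1%N; first by rewrite big_seq1.
have p_pr : prime (pdiv n) by apply: pdiv_prime; rewrite ltn_neqAle eq_sym n1.
have pn : (pdiv n %| n)%N := pdiv_dvd n; move: (pdiv n) p_pr pn => p p_pr pn.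
have p0 := prime_gt0 p_pr.
rewrite (bigID (fun d => p %| d)%N) /=.
rewrite (bigID (fun d => p * p %| d)%N) /= big1 ?add0r => [|d]; last first.
  by move=> /andP [_ /(moebius_square_dvd p_pr)].
apply/eqP; rewrite addr_eq0; apply/eqP.
rewrite -big_filter (perm_big [seq p * d | d <- divisors n & ~~ (p %| d)]%N).
  rewrite big_map big_filter -sumrN big_seq_cond [RHS]big_seq_cond.
  apply: eq_bigr => d; rewrite -dvdn_divisors // => /andP [dn pd].
  by rewrite moebius_mul_prime // (dvdn_gt0 n0 dn).
apply: uniq_perm; rewrite ?filter_uniq ?divisors_uniq //.
  rewrite map_inj_uniq ?filter_uniq ?divisors_uniq // => i j /eqP.
  by rewrite eqn_pmul2l // => /eqP.
move=> d; rewrite mem_filter -dvdn_divisors //; apply/idP/mapP => [|[e]].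
  move=> /andP [/andP [/dvdnP [e ->]]]; rewrite [(e * p)%N]mulnC dvdn_pmul2l //.
  move=> pe pen; exists e => //; rewrite mem_filter pe -dvdn_divisors //.
  by apply: dvdn_trans pen; apply: dvdn_mull.
rewrite mem_filter -dvdn_divisors // => /andP [pe en ->].
rewrite dvdn_mulr // dvdn_pmul2l // pe Gauss_dvd ?pn //.
by rewrite prime_coprime.
Qed.

Lemma big_divisors_dvd (R : Type) (idx : R) (op : Monoid.com_law idx)
    (n d : nat) (F : nat -> R) : (0 < n)%N -> (d %| n)%N ->
  \big[op/idx]_(e <- divisors d) F e =
    \big[op/idx]_(e <- divisors n | (e %| d)%N) F e.
Proof.
move=> n0 dn; have d0 := dvdn_gt0 n0 dn.
rewrite -[RHS]big_filter; apply: perm_big.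
apply: uniq_perm; rewrite ?filter_uniq ?divisors_uniq // => e.
rewrite mem_filter -!dvdn_divisors //.
by case ed: (e %| d)%N; rewrite ?(dvdn_trans ed dn).
Qed.

(** After the sums are exchanged, [H a] is weighted by the sum of mu over the divisors of n/a, which
    vanishes unless a = n. *)
Lemma moebius_inversion (V : zmodType) (H : nat -> V) (n : nat) : (0 < n)%N ->
  \sum_(b <- divisors n) \sum_(a <- divisors b) H a *~ moebius (b %/ a) = H n.
Proof.
move=> n0; transitivity (\sum_(b <- divisors n)
    \sum_(a <- divisors n | (a %| b)%N) H a *~ moebius (b %/ a)).
  rewrite big_seq [RHS]big_seq; apply: eq_bigr => b; rewrite -dvdn_divisors //.
  by move=> bn; apply: big_divisors_dvd.
rewrite (exchange_big_dep predT) //=.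
transitivity (\sum_(a <- divisors n) H a *~ (n %/ a == 1)%N%:R).
  rewrite big_seq [RHS]big_seq; apply: eq_bigr => a; rewrite -dvdn_divisors //.
  move=> an; have a0 := dvdn_gt0 n0 an.
  have na0 : (0 < n %/ a)%N by rewrite divn_gt0 // dvdn_leq.
  rewrite -sum_moebius_divisors // mulrz_sumr -big_filter.
  (* The multiples of a among the divisors of n are the a * c with c dividing n/a. *)
  rewrite (perm_big [seq (a * c)%N | c <- divisors (n %/ a)]).
    by rewrite big_map; apply: eq_bigr => c _; rewrite mulKn.
  apply: uniq_perm; rewrite ?filter_uniq ?divisors_uniq //.
    rewrite map_inj_uniq ?divisors_uniq // => i j /eqP.
    by rewrite eqn_pmul2l // => /eqP.
  move=> b; rewrite mem_filter -dvdn_divisors //; apply/idP/mapP => [|[c]].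
    move=> /andP [/dvdnP [c ->] can]; exists c; last exact: mulnC.
    by rewrite -dvdn_divisors // dvdn_divRL.
  by rewrite -dvdn_divisors // dvdn_divRL // mulnC => acn ->; rewrite dvdn_mulr.
have nn : n \in divisors n by rewrite -dvdn_divisors.
rewrite (bigD1_seq _ nn (divisors_uniq n)) /= divnn n0 big1_seq ?addr0 // => a.
rewrite -dvdn_divisors // => /andP [an and].
by rewrite (_ : (n %/ a == 1)%N = false) //; apply: contraNF an => /eqP na;
  rewrite -(divnK and) na mul1n.
Qed.

(** * Geometric sums over the multiples of b *)

(** Among the b integers from b(q+1) on, only the first is a multiple of b, so each step of the
    induction adds one power of y and the product telescopes. *)
Lemma one_minus_mul_sum_multiples (R : comNzRingType) (y : R) (b q : nat) :
  (0 < b)%N ->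
  (1 - y ^+ b) * \sum_(1 <= r < b * q.+1 | (b %| r)%N) y ^+ r =
    y ^+ b - y ^+ (b * q.+1).
Proof.
move=> b0; elim: q => [|q IH].
  rewrite muln1 subrr big_nat_cond big1 ?mulr0 // => r /andP [/andP [r0 rb]].
  by move=> /(dvdn_leq r0); rewrite leqNgt rb.
have last_block :
    \sum_(b * q.+1 <= r < b * q.+2 | (b %| r)%N) y ^+ r = y ^+ (b * q.+1).
  rewrite big_ltn_cond ?dvdn_mulr //; last lia.
  rewrite big_nat_cond big1 ?addr0 // => r /andP [/andP [lo hi]] /dvdnP [c rc].
  by move: lo hi; rewrite rc [(c * b)%N]mulnC !ltn_pmul2l //; lia.
rewrite (big_cat_nat (n := (b * q.+1)%N)) /=; [|lia|lia].
rewrite last_block mulrDr IH mulrBl mul1r -exprD -mulnS; ring.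
Qed.

(** * Limits in [Gring] and periodic series *)

Lemma Gring_cvg_unique (u : nat -> Gring) (l l' : Gring) :
  Gring_cvg u l -> Gring_cvg u l' -> l = l'.
Proof.
move=> ul ul'; apply: fpsP => i; apply: laurentP => e.
have [[n nP] [n' n'P]] := (ul i (e + 1), ul' i (e + 1)).
by rewrite -(nP (maxn n n')) ?leq_maxl -?(n'P (maxn n n')) ?leq_maxr ?ltzD1.
Qed.

Lemma eq_Gring_cvg (n1 : nat) (u v : nat -> Gring) (l : Gring) :
  (forall n, (n1 <= n)%N -> u n = v n) -> Gring_cvg u l -> Gring_cvg v l.
Proof.
move=> uv ul i N; have [n0 n0P] := ul i N; exists (maxn n0 n1) => n.
by rewrite geq_max => /andP [/n0P un /uv <-].
Qed.

Lemma Gring_cvg_shift (k : nat) (u : nat -> Gring) (l : Gring) :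
  Gring_cvg u l -> Gring_cvg (fun n => u (n + k)%N) l.
Proof.
move=> ul i N; have [n0 n0P] := ul i N; exists n0 => n nn0.
by apply: n0P; rewrite (leq_trans nn0) ?leq_addr.
Qed.

Lemma Gring_cvgDl (c : Gring) (u : nat -> Gring) (l : Gring) :
  Gring_cvg u l -> Gring_cvg (fun n => c + u n) (c + l).
Proof.
move=> ul i N; have [n0 n0P] := ul i N; exists n0 => n nn0 e eN.
by rewrite /= n0P.
Qed.

Lemma lbnd_sum (R : comNzRingType) (I : Type) (r : seq I) (F : I -> laurent R)
    (N : int) : (forall i, lbnd (F i) N) -> lbnd (\sum_(i <- r) F i) N.
Proof.
move=> FN; apply: (big_ind (fun f => lbnd f N)) => [n _|f g fN gN n nN|i _] //=.
  by case: ifP.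
by rewrite fN ?gN ?addr0.
Qed.

(** Only the coefficients of c of index j <= i enter the coefficient of t^i. The one of index j has
    order at least [M j] in L^-1, so precision [N - M j] on the other factor suffices; the finitely
    many thresholds have a maximum. *)
Lemma Gring_cvgMl (c : Gring) (u : nat -> Gring) (l : Gring) :
  Gring_cvg u l -> Gring_cvg (fun n => c * u n) (c * l).
Proof.
move=> ul i N.
have [M MP] := choice (fun j => lcoef_bounded (fcoef c j)).
have [n0 n0P] := choice (fun j => ul (i - j)%N (N - M j)).
exists (\max_(j < i.+1) n0 j) => n /bigmax_leqP nn0 e eN.
apply: subr0_eq.
rewrite -[LHS]/(lcoef (fcoef (c * u n - c * l) i) e) -mulrBr fcoefM.
apply: lbnd_sum eN => j; rewrite -[N](subrKC (M j)).
apply: lbnd_mul; first exact: MP.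
move=> e' e'N; have -> : lcoef (fcoef (u n - l) (i - j)) e' =
  lcoef (fcoef (u n) (i - j)) e' - lcoef (fcoef l (i - j)) e' by [].
by rewrite (n0P j) ?subrr //; apply: nn0.
Qed.

(** Moving the index by k turns the terms beyond k into x times all terms from 1 on; uniqueness of
    limits carries this from partial sums to s. The series in the diagonal relation is thereby
    traded for a finite sum. *)
Lemma sum_gt_periodic (k : nat) (u : nat -> Gring) (x s : Gring) :
  (forall m, (k < m)%N -> u m = x * u (m - k)%N) -> sum_gt k u s ->
  s = x * (\sum_(1 <= m < k.+1) u m + s).
Proof.
move=> ux us; apply: Gring_cvg_unique (Gring_cvg_shift k us) _.
apply: eq_Gring_cvg (Gring_cvgMl x (Gring_cvgDl _ us)).
move=> n kn; rewrite -big_cat_nat //; last exact: kn.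
rewrite mulr_sumr [RHS](@big_addn _ _ _ 1 _ k) addnK.
apply: eq_big_nat => m /andP [m0 mn].
by rewrite [RHS]ux ?addnK //; lia.
Qed.

(** * Chains and the unfolding of their last step *)

(** The weight stays abstract, with arguments a_(j-1), b_j, a_j, so that the recursion on chains
    involves no fractions. *)
Definition chain_sum (R : comNzRingType) (w : nat -> nat -> nat -> R) (a : nat) :=
  \sum_(ab \in [set ab | chain a ab]%classic)
    \prod_(1 <= j < (size ab.2).+1)
      w (tuple_a ab j.-1) (tuple_b ab j) (tuple_a ab j).

Lemma chain_last (a : nat) (ab : seq nat * seq nat) :
  chain a ab -> last 0%N ab.1 = a.
Proof. by move=> [sa _ <- _]; rewrite -nth_last sa. Qed.

Lemma chain0E (a : nat) (aa : seq nat) :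
  chain a (aa, [::]) <-> a = 1%N /\ aa = [:: 1%N].
Proof.
split=> [[/=]|[-> ->]]; last by split=> // -[].
by case: aa => [|x []] //= _; rewrite /tuple_a /= => -> <-.
Qed.

Lemma chain_rcons (a c b : nat) (aa bb : seq nat) :
  chain a (rcons aa c, rcons bb b) <->
  [/\ c = a, chain (last 0%N aa) (aa, bb), (last 0 aa <= b < a)%N,
      (last 0 aa %| b)%N & (b %| a)%N].
Proof.
rewrite /chain /tuple_a /tuple_b /= !size_rcons.
have [saa|saa] := eqVneq (size aa) (size bb).+1; last first.
  by split=> [[[]] /eqP|[_ [/eqP]]]; rewrite (negPf saa).
have aE j : (j <= size bb)%N -> nth 0%N (rcons aa c) j = nth 0%N aa j.
  by move=> jb; rewrite nth_rcons saa ltnS jb.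
have bE j : (j < size bb)%N -> nth 0%N (rcons bb b) j = nth 0%N bb j.
  by move=> jb; rewrite nth_rcons jb.
have cE : nth 0%N (rcons aa c) (size bb).+1 = c by rewrite nth_rcons saa ltnn eqxx.
have bsE : nth 0%N (rcons bb b) (size bb) = b by rewrite nth_rcons ltnn eqxx.
rewrite aE // cE -nth_last saa /=; split.
  move=> [_ a0 ca abP]; have := abP (size bb).+1.
  rewrite ltnSn /= aE // bsE cE ca => -[] // -> -> -> ->; split=> //; split=> //.
  by case=> [|j] // jb; have := abP j.+1 (leqW jb); rewrite /= aE ?bE ?aE // ltnW.
move=> [ca [_ a0 _ abP] /andP [lb ba] ldb bda]; split=> // -[|j] //.
rewrite /= ltnS leq_eqVlt => /orP [/eqP ->|jb]; first by rewrite aE // bsE cE ca; split.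
by have := abP j.+1 jb; rewrite /= aE ?bE ?aE // ltnW.
Qed.

Lemma chain_sum1 (R : comNzRingType) (w : nat -> nat -> nat -> R) :
  chain_sum w 1 = 1.
Proof.
rewrite /chain_sum (_ : [set ab | chain 1 ab]%classic = [set ([:: 1%N], [::])]%classic).
  by rewrite fsbig_set1 /= big_geq.
apply/seteqP; split=> [[aa bb]|_ ->] /=; last exact/chain0E.
case/lastP: bb => [/chain0E [_ ->] //|bb b].
case/lastP: aa => [[]//|aa c] /chain_rcons [_ _ /andP [_ b1] _ b_dvd1].
by move: b_dvd1 b1; rewrite dvdn1 => /eqP ->.
Qed.

(** Removing the last step is a bijection from the chains ending at a > 1 onto the choices of a
    divisor b < a of a, a divisor c of b and a chain ending at c. *)
Lemma chain_sum_rec (R : comNzRingType) (w : nat -> nat -> nat -> R) (a : nat) :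
  (1 < a)%N ->
  chain_sum w a = \sum_(b <- divisors a | (b < a)%N)
    \sum_(c <- divisors b) chain_sum w c * w c b a.
Proof.
move=> a1; have a0 := ltnW a1.
have sumE c (F : _ -> R) : \sum_(ab \in [set ab | chain c ab]%classic) F ab =
    \sum_(ab <- fset_set [set ab | chain c ab]%classic) F ab.
  exact/fsbig_finite/chain_finite.
have mem_chain c ab : (ab \in fset_set [set ab | chain c ab]%classic) = `[< chain c ab >].
  by rewrite in_fset_set; last exact: chain_finite.
pose last_steps := [seq (c, b) | b <- [seq b <- divisors a | (b < a)%N], c <- divisors b].
pose extend (cb : nat * nat) (ab : seq nat * seq nat) :=
  (rcons ab.1 a, rcons ab.2 cb.2).
rewrite /chain_sum sumE (perm_big [seq extend cb ab | cb <- last_steps,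
    ab <- fset_set [set ab | chain cb.1 ab]%classic]); last first.
  apply: uniq_perm; first exact: fset_uniq.
    (* The shorter chain ends at c, so the extended lists determine c as well as b. *)
    apply: allpairs_uniq_dep => [|cb _|p q]; last 1 first.
    - move=> /allpairsPdep [[c b] [[aa bb] [_ + ->]]].
      rewrite mem_chain => /asboolP /chain_last /= cE.
      move=> /allpairsPdep [[c' b'] [[aa' bb'] [_ + ->]]].
      rewrite mem_chain => /asboolP /chain_last /= c'E.
      rewrite /extend /= => -[/rcons_inj [eaa] /rcons_inj [-> ->]].
      by rewrite -cE -c'E eaa.
    - apply: allpairs_uniq_dep => [|b _|]; rewrite ?filter_uniq ?divisors_uniq //.
      by move=> [b c] [b' c'] _ _ /= [-> ->].
    - exact: fset_uniq.
  move=> [aa bb]; rewrite mem_chain; apply/asboolP/allpairsPdep => [|].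
    case/lastP: bb => [/chain0E [aE]|bb b]; first by rewrite aE in a1.
    case/lastP: aa => [[]//|aa c] /chain_rcons [-> ch /andP [lb ba] ldb bda].
    exists (last 0%N aa, b), (aa, bb); split=> //; last by rewrite mem_chain; apply/asboolP.
    apply/allpairsPdep; exists b, (last 0%N aa); split=> //.
      by rewrite mem_filter ba -dvdn_divisors.
    by rewrite -dvdn_divisors // (dvdn_gt0 a0 bda).
  move=> [cb [[aa' bb'] [+ + [-> ->]]]].
  move=> /allpairsPdep [b [c [+ + ->]]]; rewrite mem_filter -dvdn_divisors //=.
  move=> /andP [ba bda]; have b0 := dvdn_gt0 a0 bda.
  rewrite -dvdn_divisors // mem_chain => cb_dvd /asboolP ch.
  have := chain_last ch => /= lastE; apply/chain_rcons; rewrite lastE.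
  by split=> //; rewrite ba dvdn_leq.
rewrite big_allpairs_dep /last_steps big_allpairs_dep big_filter.
apply: eq_bigr => b _; apply: eq_bigr => c _.
rewrite sumE mulr_suml big_seq [RHS]big_seq; apply: eq_bigr => -[aa bb].
rewrite mem_chain => /asboolP [/= saa _ lasta _]; rewrite size_rcons big_nat_recr //=.
congr (_ * _).
  apply: eq_big_nat => j /andP [j0 jb]; rewrite /tuple_a /tuple_b /=.
  by rewrite !nth_rcons saa; do !(rewrite ifT; last lia).
by rewrite -lasta /tuple_a /tuple_b /= !nth_rcons saa !ltnn !eqxx ltnSn.
Qed.

(** * The weights and the recursion of their chain sum *)

Definition weight (c b a : nat) : Gring :=
  (moebius (b %/ c))%:~R *
  ((lambda a - 1) * tvar ^+ ((a - 1) * b) * Lvar ^- b *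
     (1 - tvar ^+ ((a - 1) * (a - b)) * Lvar ^- (a - b))
   / ((1 - lambda a * tvar ^+ (a * (a - 1)) * Lvar ^- a) *
      (1 - tvar ^+ ((a - 1) * b) * Lvar ^- b))).

Definition yvar (a : nat) : Gring := tvar ^+ (a - 1) / Lvar.

Lemma yvarX (a n : nat) : yvar a ^+ n = tvar ^+ ((a - 1) * n) * Lvar ^- n.
Proof. by rewrite exprMn -exprM exprVn. Qed.

Lemma fcoef0M (R : comNzRingType) (f g : fps R) :
  fcoef (f * g) 0 = fcoef f 0 * fcoef g 0.
Proof. by rewrite fcoefM big_ord1. Qed.

Lemma fcoef0_tvarX (n : nat) : (0 < n)%N -> fcoef (tvar ^+ n) 0 = 0.
Proof. by case: n => // n _; rewrite exprS fcoef0M mul0r. Qed.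

Lemma unit_one_sub (R : comNzRingType) (f : fps R) :
  fcoef f 0 = 0 -> 1 - f \is a GRing.unit.
Proof. by move=> f0; apply: funit_coef0; rewrite fcoefD fcoefN f0 subr0. Qed.

(** For a > 1 and n > 0 the power of [yvar a] is divisible by t, so the constant coefficient in t is
    1. *)
Lemma unit_one_sub_yvarX (c : Gring) (a n : nat) : (1 < a)%N -> (0 < n)%N ->
  1 - c * yvar a ^+ n \is a GRing.unit.
Proof.
move=> a1 n0; apply: unit_one_sub; rewrite yvarX !fcoef0M fcoef0_tvarX ?mul0r ?mulr0 //.
by rewrite muln_gt0 subn_gt0 a1.
Qed.

(** With y = [yvar a], the fraction y^b (1 - y^(a-b)) / (1 - y^b) inside [weight] is the sum of y^r
    over the positive multiples r < a of b; the left factor clears the other denominator. *)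
Lemma weightE (a b c : nat) : (1 < a)%N -> (b %| a)%N -> (b < a)%N ->
  (1 - lambda a * yvar a ^+ a) * weight c b a =
  (lambda a - 1) * ((\sum_(1 <= r < a | (b %| r)%N) yvar a ^+ r) *~ moebius (b %/ c)).
Proof.
move=> a1 ba blta; have b0 := dvdn_gt0 (ltnW a1) ba.
have u1 := unit_one_sub_yvarX (lambda a) a1 (ltnW a1).
have u2 := unit_one_sub_yvarX 1 a1 b0; rewrite mul1r in u2.
have geom : (1 - yvar a ^+ b) * \sum_(1 <= r < a | (b %| r)%N) yvar a ^+ r =
    yvar a ^+ b * (1 - yvar a ^+ (a - b)).
  rewrite mulrBr mulr1 -exprD subnKC ?(ltnW blta) //.
  have -> : a = (b * (a %/ b).-1.+1)%N.
    by rewrite prednK ?divn_gt0 ?(ltnW blta) // mulnC divnK.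
  exact: one_minus_mul_sum_multiples.
rewrite /weight [(a * (a - 1))%N]mulnC -(mulrA (lambda a)) -(mulrA (lambda a - 1)).
rewrite -!yvarX -(mulrA _ _ (1 - _)) -geom.
set S := \sum_(_ <= _ < _ | _) _; set u := 1 - yvar a ^+ b in u2 *.
set v := 1 - lambda a * _ in u1 *.
rewrite invrM //.
transitivity ((v / v) * (u / u) * ((lambda a - 1) * ((moebius (b %/ c))%:~R * S))).
  ring.
by rewrite (divrr u1) (divrr u2) !mul1r mulrzl.
Qed.

Lemma chain_sum_weight (a : nat) : (1 < a)%N ->
  (1 - lambda a * yvar a ^+ a) * chain_sum weight a =
  (lambda a - 1) * \sum_(1 <= r < a) yvar a ^+ r * chain_sum weight (gcdn a r).
Proof.
move=> a1; have a0 := ltnW a1; pose F b :=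
  \sum_(c <- divisors b) chain_sum weight c *~ moebius (b %/ c).
transitivity ((lambda a - 1) * \sum_(b <- divisors a)
    F b * \sum_(1 <= r < a | (b %| r)%N) yvar a ^+ r); last first.
  congr (_ * _); under eq_bigr do rewrite mulr_sumr.
  rewrite (exchange_big_dep predT) //=; apply: eq_big_nat => r /andP [r0 ra].
  rewrite -mulr_suml mulrC; congr (_ * _).
  (* Inversion is applied at gcd(a, r), whose divisors are the divisors of a that divide r. *)
  rewrite -(moebius_inversion _ (_ : 0 < gcdn a r)%N) ?gcdn_gt0 ?a0 //.
  rewrite [RHS](big_divisors_dvd _ _ a0) ?dvdn_gcdl //.
  rewrite big_seq_cond [RHS]big_seq_cond; apply: eq_bigl => b.
  by rewrite -dvdn_divisors // dvdn_gcd; case: (b %| a)%N.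
rewrite chain_sum_rec // !mulr_sumr big_mkcond big_seq [RHS]big_seq.
apply: eq_bigr => b; rewrite -dvdn_divisors // => ba; case: ltnP => [blta|ab].
  rewrite mulr_suml !mulr_sumr; apply: eq_bigr => c _.
  rewrite mulrCA weightE // -mulrzl -[X in _ = _ * (X * _)]mulrzl; ring.
(* The remaining case is b = a, which has no multiple r with 1 <= r < a. *)
rewrite [X in F b * X]big1_seq ?mulr0 // => r; rewrite mem_index_iota.
by move=> /andP [/dvdn_leq br /andP [/br]]; lia.
Qed.

(** * The closed form under the relations *)

Definition closed_form (k m : nat) : Gring :=
  (Lvar - 1) ^+ 2 * tvar ^+ ((k - 1) * (m - 1)) * Lvar ^- (k + m) *
    chain_sum weight (gcdn k m).

Lemma closed_formC (k m : nat) : closed_form k m = closed_form m k.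
Proof. by rewrite /closed_form mulnC addnC gcdnC. Qed.

Lemma closed_form_step (k m : nat) : (0 < k)%N -> (k < m)%N ->
  closed_form k m = tvar ^+ (k * (k - 1)) * Lvar ^- k * closed_form k (m - k)%N.
Proof.
move=> k0 km; have [d d0 ->] : exists2 d, (0 < d)%N & m = (k + d)%N.
  by exists (m - k)%N; lia.
rewrite /closed_form addKn gcdnDl -!exprVn.
(* Subtraction is truncated: d > 0 makes k + d - 1 equal to k + (d - 1). *)
have -> : ((k - 1) * (k + d - 1) = k * (k - 1) + (k - 1) * (d - 1))%N by nia.
rewrite !exprD; ring.
Qed.

(** Isolates a factor that does not depend on r, so that the sum over r < a becomes the one in
    [chain_sum_weight]. *)
Lemma closed_form_row (a r : nat) : (0 < a)%N -> (0 < r)%N ->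
  yvar a ^+ a * closed_form a r =
  (Lvar - 1) ^+ 2 * tvar ^+ ((a - 1) * (a - 1)) * Lvar ^- (a + a) *
    (yvar a ^+ r * chain_sum weight (gcdn a r)).
Proof.
move=> a0 r0; rewrite /closed_form !yvarX -!exprVn.
have e1 : tvar ^+ ((a - 1) * a) * tvar ^+ ((a - 1) * (r - 1)) =
    tvar ^+ ((a - 1) * (a - 1)) * tvar ^+ ((a - 1) * r).
  by rewrite -!exprD; congr (_ ^+ _); nia.
transitivity ((tvar ^+ ((a - 1) * a) * tvar ^+ ((a - 1) * (r - 1))) *
    ((Lvar - 1) ^+ 2 * Lvar^-1 ^+ a * Lvar^-1 ^+ (a + r) *
     chain_sum weight (gcdn a r))); first by ring.
rewrite e1 !exprD; ring.
Qed.

(** * Agreement of the given family with the closed form *)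

Section RecursiveFamily.
Variable G : nat -> nat -> Gring.
Hypothesis G11 : G 1 1 = (Lvar - 1) ^+ 2 * Lvar ^- 2.
Hypothesis Gsym : forall k m, (1 <= k)%N -> (1 <= m)%N -> G k m = G m k.
Hypothesis Gstep : forall k m, (1 <= k)%N -> (k < m)%N ->
  G k m = tvar ^+ (k * (k - 1)) * Lvar ^- k * G k (m - k)%N.
Hypothesis Gdiag : forall k, (1 <= k)%N ->
  exists2 s, sum_gt k (G k) s & G k k = (lambda k - 1) * s.

(** Subtractive Euclidean algorithm, by induction on k + m: both sides obey the same step, which
    keeps the gcd, until the diagonal is reached at a. *)
Lemma G_of_diag (a k m : nat) : G a a = closed_form a a ->
  (0 < k)%N -> (0 < m)%N -> gcdn k m = a -> G k m = closed_form k m.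
Proof.
move=> Ga; have [n] := ubnP (k + m); elim: n k m => // n IH k m kmn k0 m0 kma.
wlog km : k m kmn k0 m0 kma / (k <= m)%N.
  move=> wl; case: (leqP k m) => [|/ltnW] km; first exact: wl.
  by rewrite Gsym // closed_formC; apply: wl; rewrite // 1?addnC 1?gcdnC.
have [kE|km'] := eqVneq k m; first by rewrite -kE gcdnn in kma *; rewrite kma.
have {km km'} km : (k < m)%N by rewrite ltn_neqAle km'.
rewrite Gstep // closed_form_step //; congr (_ * _); apply: IH => //; try lia.
by rewrite -kma -[in RHS](subnKC (ltnW km)) gcdnDl.
Qed.

(** Strong induction: for 0 < r < a the gcd of a and r is below a, so the entries [G a r] are known
    and the diagonal relation yields [G a a]. *)
Lemma G_diag (a : nat) : (0 < a)%N -> G a a = closed_form a a.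
Proof.
elim/ltn_ind: a => a IH a0; have [->|a1] := eqVneq a 1%N.
  (* For a = 1 the factor 1 - lambda_1 y is 1 - L L^-1 = 0, so the diagonal relation cannot be
     solved for [G 1 1], and its given value starts the induction. *)
  by rewrite G11 /closed_form gcdnn chain_sum1 expr0 !mulr1.
have {a1} a1 : (1 < a)%N by rewrite ltn_neqAle eq_sym a1.
have [s sG Gaa] := Gdiag a0.
have Gper m : (a < m)%N -> G a m = yvar a ^+ a * G a (m - a)%N.
  by move=> am; rewrite Gstep // yvarX [(a * _)%N]mulnC.
have := sum_gt_periodic Gper sG; rewrite big_nat_recr //= => sE.
apply: (mulrI (unit_one_sub_yvarX (lambda a) a1 a0)).
transitivity ((lambda a - 1) * (yvar a ^+ a * \sum_(1 <= r < a) G a r)).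
  (* The finite sum is isolated in [sE]. As [G a a + s] equals [lambda a * s], the factor 1 -
     lambda_a y^a then comes out. *)
  have {}sE : yvar a ^+ a * \sum_(1 <= r < a) G a r =
      s - yvar a ^+ a * (G a a + s) by rewrite {1}sE; ring.
  by rewrite sE Gaa; ring.
have rowE r : (0 < r < a)%N -> yvar a ^+ a * G a r =
    (Lvar - 1) ^+ 2 * tvar ^+ ((a - 1) * (a - 1)) * Lvar ^- (a + a) *
      (yvar a ^+ r * chain_sum weight (gcdn a r)).
  move=> /andP [r0 ra]; rewrite -closed_form_row //; congr (_ * _).
  have gcd0 : (0 < gcdn a r)%N by rewrite gcdn_gt0 a0.
  apply: G_of_diag (erefl _) => //; apply: IH => //.
  by rewrite (leq_ltn_trans _ ra) // dvdn_leq ?dvdn_gcdr.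
rewrite mulr_sumr (eq_big_nat _ _ rowE) -mulr_sumr mulrCA -chain_sum_weight //.
by rewrite mulrCA /closed_form gcdnn.
Qed.

End RecursiveFamily.

Theorem theorem3
  (G : nat -> nat -> Gring)
  (G11 : G 1%N 1%N = (Lvar - 1) ^+ 2 * Lvar ^- 2)
  (Gsym : forall k m : nat, (1 <= k)%N -> (1 <= m)%N -> G k m = G m k)
  (Gstep : forall k m : nat, (1 <= k)%N -> (k < m)%N ->
     G k m = tvar ^+ (k * (k - 1)) * Lvar ^- k * G k (m - k)%N)
  (Gdiag : forall k : nat, (1 <= k)%N ->
     exists2 s : Gring, sum_gt k (G k) s & G k k = (lambda k - 1) * s)
  (k m : nat) (hk : (1 <= k)%N) (hm : (1 <= m)%N) :
  G k m =
    (Lvar - 1) ^+ 2 * tvar ^+ ((k - 1) * (m - 1)) * Lvar ^- (k + m) *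
    \sum_(ab \in [set ab | chain (gcdn k m) ab]%classic)
      \prod_(1 <= j < (size ab.2).+1)
        let a := tuple_a ab j in
        let b := tuple_b ab j in
        (moebius (b %/ tuple_a ab j.-1))%:~R *
        ((lambda a - 1) * tvar ^+ ((a - 1) * b) * Lvar ^- b *
           (1 - tvar ^+ ((a - 1) * (a - b)) * Lvar ^- (a - b))
         / ((1 - lambda a * tvar ^+ (a * (a - 1)) * Lvar ^- a) *
            (1 - tvar ^+ ((a - 1) * b) * Lvar ^- b))).
Proof.
have gcd0 : (0 < gcdn k m)%N by rewrite gcdn_gt0 hk.
exact: (G_of_diag Gsym Gstep (G_diag G11 Gsym Gstep Gdiag gcd0) hk hm (erefl _)).
Qed.
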